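(* Let $n\geq 2$ and let $(X_1,Y_1),\ldots,(X_n,Y_n)$ be independent (not necessarily identically distributed) random vectors in $\mathbb{R}^2$ with absolutely continuous bivariate distribution functions $F_1,\ldots,F_n$. Let $\tilde{\tau}_n$ be the rank Kendall correlation coefficient and let $\tau_n$ be the theoretical Kendall correlation coefficient of these vectors. Then $$E\tilde{\tau}_n=\tau_n .$$
   Context: Setting: $(X_i,Y_i)$ has distribution function $F_i(x,y)=P(X_i\leq x,\ Y_i\leq y)$ and density $f_i(x,y)$ with respect to Lebesgue measure on $\mathbb{R}^2$. Concomitants: let $X_{1,n}\leq\cdots\leq X_{n,n}$ be the order statistics of $X_1,\ldots,X_n$ (ties occur with probability zero). If $X_i=X_{j,n}$, then $Y_{j,n}:=Y_i$ is called the concomitant of $X_{j,n}$. So $Y_{1,n},\ldots,Y_{n,n}$ are the $Y$-values rearranged according to the increasing order of the $X$-values. Rank Kendall correlation coefficient: with $I_{ji}=I(Y_{j,n}\leq Y_{i,n})$, where $I$ is the indicator function, $$\tilde{\tau}_n=\frac{4\sum_{i=2}^n\sum_{j=1}^{i-1}I_{ji}}{n(n-1)}-1 .$$ Theoretical Kendall correlation coefficient (non-identically distributed case): $$\tau_n=\frac{4\sum_{i=1}^n\sum_{j=1,\,j\neq i}^n E[F_i(X_j,Y_j)]}{n(n-1)}-1=\frac{4\sum_{i=1}^n\sum_{j=1,\,j\neq i}^n \int_{\mathbb{R}^2}F_i(x,y)f_j(x,y)\,dx\,dy}{n(n-1)}-1 .$$ *)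

(* Defs.v *)
From HB Require Import structures.
From mathcomp Require Import all_boot all_order all_algebra.
From mathcomp Require Import all_classical all_reals all_analysis.

Set Implicit Arguments.
Unset Strict Implicit.
Unset Printing Implicit Defensive.

Import Order.TTheory GRing.Theory Num.Theory.
Import numFieldNormedType.Exports.

Local Open Scope classical_set_scope.
Local Open Scope ring_scope.

Definition mutually_independent d d' (T : measurableType d)
    (S : measurableType d') (R : realType) (P : probability T R) (I : finType)
    (Z : I -> {RV P >-> S}) : Prop :=
  forall (J : {set I}) (A : I -> set S), (forall i, measurable (A i)) ->
    P (\bigcap_(i in [set i | i \in J]) (Z i @^-1` A i)) =
    (\prod_(i in J) P (Z i @^-1` A i))%E.

Definition joint_cdf d (T : measurableType d) (R : realType)
    (P : probability T R) (Z : {RV P >-> (R * R)%type}) (z : R * R) : R :=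
  fine (P [set w | (Z w).1 <= z.1 /\ (Z w).2 <= z.2]).

Definition has_density d (T : measurableType d) (R : realType)
    (P : probability T R) (Z : {RV P >-> (R * R)%type}) (f : R * R -> R) : Prop :=
  [/\ measurable_fun setT f, forall z, 0 <= f z &
      forall A, measurable A ->
        distribution P Z A =
          (\int[lebesgue_measure \x lebesgue_measure]_(z in A) (f z)%:E)%E].

(* The sample indices listed by increasing first coordinate.  The sort is
   stable, so that ties (a null event for independent vectors with densities)
   are broken by the index. *)
Definition xorder (R : realType) (n : nat) (z : 'I_n -> R * R) : seq 'I_n :=
  sort (fun i k => (z i).1 <= (z k).1) (enum 'I_n).

(* Ranks are counted from 0: X_{j+1,n} and Y_{j+1,n} in the usual notation. *)
Definition order_stat (R : realType) (n : nat) (z : 'I_n -> R * R)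
    (j : 'I_n) : R := nth 0 [seq (z i).1 | i <- xorder z] j.

Definition concomitant (R : realType) (n : nat) (z : 'I_n -> R * R)
    (j : 'I_n) : R := nth 0 [seq (z i).2 | i <- xorder z] j.

Lemma size_xorder (R : realType) (n : nat) (z : 'I_n -> R * R) :
  size (xorder z) = n.
Proof. by rewrite size_sort size_enum_ord. Qed.

Lemma order_stat_le (R : realType) (n : nat) (z : 'I_n -> R * R)
    (j k : 'I_n) : (j <= k)%N -> order_stat z j <= order_stat z k.
Proof.
move=> jk; rewrite /order_stat.
have s_le : sorted <=%R [seq (z i).1 | i <- xorder z].
  rewrite sorted_map; apply: sort_sorted => a b; exact: le_total.
by apply: (sorted_leq_nth le_trans lexx) => //;
  rewrite inE size_map size_xorder.
Qed.

Lemma concomitantE (R : realType) (n : nat) (z : 'I_n -> R * R)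
    (i j : 'I_n) : injective (fun k => (z k).1) ->
  (z i).1 = order_stat z j -> concomitant z j = (z i).2.
Proof.
move=> z_inj; rewrite /order_stat /concomitant.
rewrite !(nth_map i) ?size_xorder//.
by move=> /z_inj <-.
Qed.

Definition rank_kendall_tau (R : realType) (n : nat) (z : 'I_n -> R * R) : R :=
  4 * (\sum_(i < n) \sum_(j < n | (j < i)%N)
         (concomitant z j <= concomitant z i)%R%:R) / (n%:R * (n%:R - 1)) - 1.

Definition kendall_tau d (T : measurableType d) (R : realType)
    (P : probability T R) (n : nat)
    (Z : 'I_n -> {RV P >-> (R * R)%type}) : \bar R :=
  ((4 / (n%:R * (n%:R - 1)))%:E *
     (\sum_(i < n) \sum_(j < n | j != i)
        'E_P[fun w => joint_cdf (Z i) (Z j w)]) - 1)%E.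

Definition kendall_tau_density d (T : measurableType d) (R : realType)
    (P : probability T R) (n : nat)
    (Z : 'I_n -> {RV P >-> (R * R)%type}) (f : 'I_n -> R * R -> R) : \bar R :=
  ((4 / (n%:R * (n%:R - 1)))%:E *
     (\sum_(i < n) \sum_(j < n | j != i)
        \int[lebesgue_measure \x lebesgue_measure]_z
          (joint_cdf (Z i) z * f j z)%:E) - 1)%E.

(* Main.v *)
Require Import Defs.
From HB Require Import structures.
From mathcomp Require Import all_boot all_order all_algebra.
From mathcomp Require Import all_classical all_reals all_analysis.
From mathcomp Require Import measurable_realfun.

(* Summing over pairs of ranks is the same as summing over pairs of indices:
   the numerator of the rank coefficient counts the ordered pairs of distinct
   indices (i, j) such that i precedes j in the order of the first coordinates
   and Y_i <= Y_j.  Since ties are broken by the index, "i precedes j" is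
   exactly X_i <= X_j if i < j and X_i < X_j otherwise, which is written
   [X_i < X_j ?<= if i < j].  By independence and Tonelli, the probability of
   such an event is the integral over the law of (X_j, Y_j) of the
   (X_i, Y_i)-mass of a quadrant, whose vertical boundary is null by absolute
   continuity; this mass is therefore F_i whether or not the inequality on the
   first coordinates is strict. *)

Set Implicit Arguments.
Unset Strict Implicit.
Unset Printing Implicit Defensive.

Import Order.TTheory GRing.Theory Num.Theory.
Import numFieldNormedType.Exports.

Local Open Scope classical_set_scope.
Local Open Scope ring_scope.

(** * Ranks and the order of the first coordinates *)

Lemma nth_xorder_inj (R : realType) (n : nat) (z : 'I_n -> R * R) (i0 : 'I_n) :
  injective (fun k : 'I_n => nth i0 (xorder z) k).
Proof.
move=> j k /eqP; rewrite nth_uniq ?size_xorder// ?sort_uniq ?enum_uniq//.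
by move=> /eqP/val_inj.
Qed.

(** A stable sort of the increasing enumeration of the indices is sorted for the strict
    lexicographic order on (first coordinate, index), and a strict order determines positions in
    both directions. *)
Lemma ltn_xorder (R : realType) (n : nat) (z : 'I_n -> R * R)
    (i0 j k : 'I_n) :
  let s := xorder z in
  (j < k)%N = ((z (nth i0 s j)).1 < (z (nth i0 s k)).1
                 ?<= if (nth i0 s j < nth i0 s k)%N).
Proof.
move=> s.
(* The lexicographic order, in the shape that [sort_stable] delivers. *)
pose before := [rel a b : 'I_n | ((z a).1 <= (z b).1) &&
  (((z b).1 <= (z a).1) ==> (a < b)%N)].
have beforeE a b : before a b = ((z a).1 < (z b).1 ?<= if (a < b)%N).
  by rewrite /= /Order.lteif; case: (a < b)%N => /=; rewrite ?implybT ?andbT//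
    implybF -ltNge; case: ltgtP.
have before_tr : transitive before.
  move=> b a c /= /andP[ab /implyP abI] /andP[bc /implyP bcI].
  rewrite (le_trans ab bc)/=; apply/implyP => ca.
  exact: ltn_trans (abI (le_trans bc ca)) (bcI (le_trans ca ab)).
have before_s : sorted before s.
  apply: sort_stable => [a b|b a c|]; [exact: le_total|exact: ltn_trans|].
  by have := iota_ltn_sorted 0 n; rewrite -val_enum_ord sorted_map.
have sE a : a \in gtn (size s) = (a < n)%N by rewrite inE size_xorder.
rewrite -beforeE; apply/idP/idP => [jk|].
  by apply: (sorted_ltn_nth before_tr) => //; rewrite sE.
(* Equal ranks contradict irreflexivity; [k < j] would give [before] both ways, hence two indices
   each below the other. *)
rewrite ltnNge; apply: contraL; rewrite leq_eqVlt => /predU1P[/val_inj ->|kj].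
  by rewrite /= lexx ltnn.
have /= := sorted_ltn_nth before_tr i0 before_s k j.
rewrite !sE => /(_ (ltn_ord k) (ltn_ord j) kj) /andP[kj1 /implyP kjI].
apply/negP => /andP[jk1 /implyP jkI].
by have := ltn_trans (kjI jk1) (jkI kj1); rewrite ltnn.
Qed.

Lemma sum_concomitants (R : realType) (n : nat) (z : 'I_n -> R * R) :
  \sum_(i < n) \sum_(j < n | (j < i)%N)
      (concomitant z j <= concomitant z i)%R%:R =
  \sum_(p : 'I_n * 'I_n | p.2 != p.1)
    (((z p.1).1 < (z p.2).1 ?<= if (p.1 < p.2)%N) &&
     ((z p.1).2 <= (z p.2).2))%:R :> R.
Proof.
case: n z => [|n] z; first by rewrite big_ord0 big1// => -[[]].
pose s := xorder z.
have h : bijective (fun k : 'I_n.+1 => nth ord0 s k).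
  exact/injF_bij/nth_xorder_inj.
pose G a b : R := (((z b).1 < (z a).1 ?<= if (b < a)%N) &&
     ((z b).2 <= (z a).2))%:R.
(* The later element of each pair becomes the outer index, to match the outer rank [i]. *)
rewrite -(pair_big_dep predT (fun b a => a != b) (fun b a => G a b))/=.
rewrite [RHS](exchange_big_dep predT)//=.
rewrite [RHS](reindex _ (onW_bij _ h))/=; apply: eq_bigr => i _.
rewrite [RHS](reindex _ (onW_bij _ h))/=.
(* By [ltn_xorder], the ranks [j] that are not below [i] contribute zero. *)
rewrite [RHS](bigID (fun j : 'I_n.+1 => (j < i)%N))/=.
rewrite [X in _ = _ + X]big1 ?addr0 => [|j /andP[_]]; last first.
  by rewrite (@ltn_xorder _ _ z ord0) /G => /negbTE ->.
apply: eq_big => [j|j ji].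
  rewrite eq_sym (inj_eq (@nth_xorder_inj _ _ z ord0)).
  by case: (ltnP j i) => ji; rewrite ?andbF// andbT -val_eqE ltn_eqF.
by rewrite /G -(@ltn_xorder _ _ z ord0) ji /= /concomitant
  !(nth_map ord0) ?size_xorder.
Qed.

(** * Measures with a density *)

Section density.
Local Open Scope ereal_scope.
Context d (T : measurableType d) (R : realType).
Variables (mu : {sigma_finite_measure set T -> \bar R})
  (nu : {finite_measure set T -> \bar R}) (f : T -> R).
Hypotheses (mf : measurable_fun setT f)
  (nuE : forall A, measurable A -> nu A = \int[mu]_(x in A) (f x)%:E).

Lemma density_dominates : nu `<< mu.
Proof.
apply/null_content_dominatesP => A mA A0; rewrite nuE// null_set_integral//.
exact/measurable_EFinP/measurable_funTS.
Qed.

(** The Radon-Nikodym derivative of [nu] and [f] have equal integrals over every measurable set, so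
    they agree [mu]-almost everywhere. *)
Lemma integral_density (g : T -> \bar R) : nu.-integrable setT g ->
  \int[nu]_x g x = \int[mu]_x (g x * (f x)%:E).
Proof.
move=> gi; rewrite -(Radon_Nikodym_change_of_variables density_dominates)//.
apply: ae_eq_integral => //.
- apply: emeasurable_funM; first exact: measurable_int gi.
  apply: measurable_int; apply: Radon_Nikodym_integrable.
  exact: density_dominates.
- apply: emeasurable_funM; first exact: measurable_int gi.
  exact/measurable_EFinP.
- apply: ae_eqe_mul2l.
  apply: integral_ae_eq => //.
  + by apply: Radon_Nikodym_integrable; exact: density_dominates.
  + exact/measurable_EFinP.
  + move=> E _ mE; rewrite -nuE// -Radon_Nikodym_integral//.
    exact: density_dominates.
Qed.

End density.

(** * Independent pairs, null lines and quadrants *)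

Lemma independent_pair d d' (T : measurableType d) (S : measurableType d')
    (R : realType) (P : probability T R) (I : finType)
    (Z : I -> {RV P >-> S}) (a b : I) (A : set (S * S)) :
  mutually_independent Z -> a != b -> measurable A ->
  P [set w | A (Z a w, Z b w)] =
  (distribution P (Z a) \x distribution P (Z b))%E A.
Proof.
move=> indZ ab mA.
have mZ : measurable_fun setT (fun w => (Z a w, Z b w)).
  exact: measurable_fun_pair.
pose W : {mfun T >-> (S * S)%type} := mfun_Sub (mem_set mZ).
(* It suffices to compare the two measures on rectangles. *)
rewrite (@product_measure_unique _ _ _ _ _ (distribution P (Z a))
  (distribution P (Z b)) (distribution P W))// => B C mB mC.
have mBC i : measurable (if i == a then B else C) by case: ifP.
have := indZ [set a; b]%SET _ mBC.
rewrite big_setU1 ?inE//= big_set1 eqxx eq_sym (negbTE ab) => <-.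
congr (P _); apply/seteqP; split => w /=.
  move=> [Bw Cw] i /=; rewrite !inE => /orP[] /eqP ->; first by rewrite eqxx.
  by rewrite eq_sym (negbTE ab).
move=> h; split.
  by have := h a; rewrite /= !inE eqxx; exact.
by have := h b; rewrite /= !inE eqxx orbT eq_sym (negbTE ab); exact.
Qed.

Lemma density_vertical_line0 (R : realType) d (T : measurableType d)
    (P : probability T R) (Z : {RV P >-> (R * R)%type}) (f : R * R -> R)
    (c : R) :
  has_density Z f ->
  measurable [set z : R * R | z.1 = c] /\
  distribution P Z [set z | z.1 = c] = 0%E.
Proof.
move=> [mf f0 fE].
have -> : [set z : R * R | z.1 = c] = [set c] `*` setT.
  by apply/seteqP; split=> [z|z []].
have mc : measurable ([set c] `*` [set: R]) by exact: measurableX.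
split=> //; rewrite fE// null_set_integral//.
  exact/measurable_EFinP/measurable_funTS.
rewrite [LHS]product_measure1E//.
by rewrite [X in (X * _)%E](lebesgue_measure_set1 c) mul0e.
Qed.

(** Here [p.1] is the vertex and [p.2] the point compared with it, so the section at [u] is the
    quadrant with upper right corner [u]. *)
Lemma measurable_before (R : realType) (t : bool) :
  measurable [set p : (R * R) * (R * R) |
    (p.2.1 < p.1.1 ?<= if t) && (p.2.2 <= p.1.2)].
Proof.
have m1 : measurable_fun setT (fun p : (R * R) * (R * R) => p.1.1).
  exact: measurableT_comp.
have m2 : measurable_fun setT (fun p : (R * R) * (R * R) => p.2.1).
  exact: measurableT_comp.
rewrite -[X in measurable X]setTI.
apply: (_ : measurable_fun setT (fun p : (R * R) * (R * R) =>
  (p.2.1 < p.1.1 ?<= if t) && (p.2.2 <= p.1.2))) => //.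
apply: measurable_and.
  by case: t; [exact: measurable_fun_ler|exact: measurable_fun_ltr].
by apply: measurable_fun_ler; exact: measurableT_comp.
Qed.

(** * Distribution functions as masses of quadrants *)

Section joint_cdf.
Context d (T : measurableType d) (R : realType) (P : probability T R)
  (Z : {RV P >-> (R * R)%type}).

Lemma joint_cdfE (u : R * R) : (joint_cdf Z u)%:E =
  distribution P Z (xsection [set p | (p.2.1 <= p.1.1) && (p.2.2 <= p.1.2)] u).
Proof.
rewrite /joint_cdf -[RHS]fineK; last first.
  rewrite fin_num_measure//.
  exact: measurable_xsection (@measurable_before R true).
congr (fine (P _))%:E; apply/seteqP; split => w; rewrite /xsection /= inE.
  by move=> h; apply/andP.
by move/andP.
Qed.

Lemma distribution_before (f : R * R -> R) (t : bool) (u : R * R) :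
  has_density Z f ->
  distribution P Z (xsection [set p |
    (p.2.1 < p.1.1 ?<= if t) && (p.2.2 <= p.1.2)] u) = (joint_cdf Z u)%:E.
Proof.
move=> Zf; rewrite joint_cdfE; case: t => //.
have [mL L0] := @density_vertical_line0 _ _ _ _ _ _ u.1 Zf.
set A := xsection _ u; set B := xsection _ u.
have mA : measurable A by exact: measurable_xsection (@measurable_before R false).
have mB : measurable B by exact: measurable_xsection (@measurable_before R true).
apply/eqP; rewrite eq_le; apply/andP; split.
  apply: le_measure; rewrite ?inE// => v.
  by rewrite /A /B /xsection /= !inE /= => /andP[/ltW -> ->].
(* The closed quadrant [B] is covered by [A] and the null line through [u]. *)
rewrite -[leRHS]adde0 -L0; apply: le_trans (measureU2 _ mA mL).
apply: le_measure; rewrite ?inE//; first exact: measurableU.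
move=> v; rewrite /A /B /xsection /= !inE /= => /andP[].
by rewrite le_eqVlt => /predU1P[|->] => [|->]; [right|left].
Qed.

Lemma measurable_joint_cdf : measurable_fun setT (joint_cdf Z).
Proof.
apply/measurable_EFinP.
apply: (eq_measurable_fun (distribution P Z \o
  xsection [set p | (p.2.1 <= p.1.1) && (p.2.2 <= p.1.2)])).
  by move=> u _; rewrite /= joint_cdfE.
exact: measurable_fun_xsection (@measurable_before R true).
Qed.

End joint_cdf.

(** * Sigma-finiteness of product measures *)

Section sigma_finite_product.
Local Open Scope ereal_scope.
Context d1 d2 (T1 : measurableType d1) (T2 : measurableType d2) (R : realType)
  (m1 : {sigma_finite_measure set T1 -> \bar R})
  (m2 : {sigma_finite_measure set T2 -> \bar R}).

(* A separate name for [m1 \x m2], since on that expression itself the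
   sigma-finiteness instance of the library is shadowed by the one for
   products of subprobabilities. *)
Definition sigma_finite_product := m1 \x m2.

HB.instance Definition _ := Measure.on sigma_finite_product.

Lemma sigma_finite_productT : sigma_finite setT sigma_finite_product.
Proof.
(* Nondecreasing exhaustions, so that one index, the maximum, serves both coordinates. *)
have /sigma_finiteP[F [FT F_nd Foo]] := sigma_finiteT m1.
have /sigma_finiteP[G [GT G_nd Goo]] := sigma_finiteT m2.
exists (fun k => F k `*` G k).
  apply/seteqP; split=> // -[x y] _.
  have [i _ Fx] : (\bigcup_k F k) x by rewrite -FT.
  have [j _ Gy] : (\bigcup_k G k) y by rewrite -GT.
  exists (maxn i j) => //; split=> /=.
    exact: (subsetPset _ _ (F_nd _ _ (leq_maxl i j))).
  exact: (subsetPset _ _ (G_nd _ _ (leq_maxr i j))).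
move=> k; have [mF Fk] := Foo k; have [mG Gk] := Goo k.
split; first exact: measurableX.
by rewrite [ltLHS]product_measure1E// lte_mul_pinfty// ge0_fin_numE.
Qed.

HB.instance Definition _ := Measure_isSigmaFinite.Build _ _ _
  sigma_finite_product sigma_finite_productT.

End sigma_finite_product.

(** * Expectation of the rank coefficient *)

Section expectation.
Local Open Scope ereal_scope.
Context d (T : measurableType d) (R : realType) (P : probability T R) (n : nat)
  (Z : 'I_n -> {RV P >-> (R * R)%type}) (f : 'I_n -> R * R -> R).
Hypotheses (indZ : mutually_independent Z)
  (Zf : forall i, has_density (Z i) (f i)).

Let before i j := [set w | (((Z i w).1 < (Z j w).1 ?<= if (i < j)%N) &&
  ((Z i w).2 <= (Z j w).2))%R].

Lemma measurable_before_RV i j : measurable (before i j).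
Proof.
have mZ : measurable_fun setT (fun w => (Z j w, Z i w)).
  exact: measurable_fun_pair.
by have := mZ measurableT _ (@measurable_before R (i < j)%N); rewrite setTI.
Qed.

Lemma expectation_joint_cdf i j :
  'E_P[fun w => joint_cdf (Z i) (Z j w)] =
  \int[distribution P (Z j)]_u (joint_cdf (Z i) u)%:E.
Proof.
rewrite unlock.
rewrite (ge0_integral_distribution (Z j) (f := EFin \o joint_cdf (Z i)))//.
  by apply/measurable_EFinP; exact: measurable_joint_cdf.
by move=> u; rewrite lee_fin fine_ge0.
Qed.

Lemma probability_before i j : j != i ->
  P (before i j) = 'E_P[fun w => joint_cdf (Z i) (Z j w)].
Proof.
move=> ji; rewrite expectation_joint_cdf.
(* [Z j] comes first in the pair, as the vertex: the product measure is by definition the integral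
   of the section masses over its law. *)
rewrite (independent_pair indZ ji (@measurable_before R (i < j)%N)).
by apply: eq_integral => u _; exact: distribution_before (Zf i).
Qed.

Lemma expectation_joint_cdf_density i j :
  'E_P[fun w => joint_cdf (Z i) (Z j w)] =
  \int[lebesgue_measure \x lebesgue_measure]_z (joint_cdf (Z i) z * f j z)%:E.
Proof.
have [mf f0 fE] := Zf j.
(* [lebesgue_measure] lives on [measurableTypeR R], which has the same
   measurable sets as [R] but is a different structure: hence the transport of
   [Z j] to [RR]. *)
pose RR : measurableType _ := (measurableTypeR R * measurableTypeR R)%type.
have mZ : measurable_fun setT (Z j : T -> RR) by exact: (measurable_funP (Z j)).
pose W : {mfun T >-> RR} := @mfun_Sub _ _ T RR _ (mem_set mZ).
have mF : measurable_fun setT (joint_cdf (Z i) : RR -> R).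
  exact: measurable_joint_cdf.
have F0 u : (0 <= joint_cdf (Z i) u)%R by exact: fine_ge0.
have F1 u : (joint_cdf (Z i) u <= 1)%R.
  rewrite -lee_fin joint_cdfE probability_le1//.
  exact: measurable_xsection (@measurable_before R true).
rewrite unlock -(ge0_integral_distribution W (f := EFin \o joint_cdf (Z i)))//.
- under [RHS]eq_integral do rewrite EFinM.
  apply: (@integral_density _ RR R
    (sigma_finite_product lebesgue_measure lebesgue_measure)
    (distribution P W) (f j) mf fE).
  apply: measurable_bounded_integrable => //.
    by rewrite [ltLHS]probability_setT ltry.
  exists 1%R; split=> // r r1 u _; rewrite /= ger0_norm//.
  exact: le_trans (F1 u) (ltW r1).
- exact/measurable_EFinP.
Qed.

Lemma expectation_rank_kendall_tau :
  'E_P[fun w => rank_kendall_tau (fun i => Z i w)] = kendall_tau Z.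
Proof.
pose c : R := (4 / (n%:R * (n%:R - 1)))%R.
pose S w : \bar R := \sum_(p : 'I_n * 'I_n | p.2 != p.1)
  (\1_(before p.1 p.2) w)%:E.
have mb := measurable_before_RV.
have iS : P.-integrable setT S.
  by apply: integrable_sum => // p _; exact: integrable_indic.
(* The coefficient is affine in a finite sum of indicators, so linearity reduces its expectation to
   probabilities of pairs. *)
have -> : 'E_P[fun w => rank_kendall_tau (fun i => Z i w)] =
    \int[P]_w (c%:E * S w - (cst 1 w)).
  rewrite unlock; apply: eq_integral => w _.
  rewrite /rank_kendall_tau sum_concomitants mulrAC -/c EFinB EFinM -sumEFin.
  congr (_ * _ - _); apply: eq_bigr => p _; rewrite indicE; congr (_%:R%:E).
  by congr nat_of_bool; apply/idP/idP; rewrite inE.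
rewrite integralB//; [|exact: integrableZl|exact: finite_measure_integrable_cst].
rewrite integralZl// integral_cst// [X in _ - _ * X]probability_setT mule1.
congr (_ * _ - _).
rewrite integral_sum//; last by move=> p; exact: integrable_indic.
rewrite (pair_big_dep predT (fun i j => j != i)
  (fun i j => 'E_P[fun w => joint_cdf (Z i) (Z j w)])); apply: eq_bigr => p pp.
by rewrite integral_indic// setIT [LHS]probability_before.
Qed.

End expectation.

Theorem theorem2p1 (R : realType) (d : measure_display) (T : measurableType d)
    (P : probability T R) (n : nat) (hn : (2 <= n)%N)
    (Z : 'I_n -> {RV P >-> (R * R)%type}) (f : 'I_n -> R * R -> R)
    (hind : mutually_independent Z)
    (hf : forall i, has_density (Z i) (f i)) :
  ('E_P[fun w => rank_kendall_tau (fun i => Z i w)] = kendall_tau Z)%E /\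
  ('E_P[fun w => rank_kendall_tau (fun i => Z i w)] = kendall_tau_density Z f)%E.
Proof.
have E := expectation_rank_kendall_tau hind hf.
split=> //; rewrite E /kendall_tau /kendall_tau_density.
congr (_ * _ - _)%E; apply: eq_bigr => i _; apply: eq_bigr => j _.
exact: expectation_joint_cdf_density.
Qed.
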